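(* Let $m\geq 1$. Then: (a) For all $s\geq 3$, $\Gamma_s(B_m(\mathbb{D}^2))=\Gamma_2(B_m(\mathbb{D}^2))$. (b) If $m=1,2$ then $(B_m(\mathbb{D}^2))^{(s)}=\{1\}$ for all $s\geq 1$. (c) If $m=3$ then the derived series of $(B_3(\mathbb{D}^2))^{(1)}$ is that of the free group $\mathbb{F}_2(u,v)$ on two generators $u$ and $v$, where $u=\sigma_2\sigma_1^{-1}$ and $v=\sigma_1u\sigma_1^{-1}=\sigma_1\sigma_2\sigma_1^{-2}$. Further, $$B_3(\mathbb{D}^2)/(B_3(\mathbb{D}^2))^{(2)}\cong\mathbb{Z}^2\rtimes\mathbb{Z},$$ where $\mathbb{Z}^2$ is the free Abelian group generated by the respective Abelianisations $\overline{u}$ and $\overline{v}$ of $u$ and $v$, and the action is given by $\sigma\cdot\overline{u}=\overline{v}$ and $\sigma\cdot\overline{v}=-\overline{u}+\overline{v}$, where $\sigma$ is a generator of $\mathbb{Z}$. (d) If $m=4$ then $$(B_4(\mathbb{D}^2))^{(1)}/(B_4(\mathbb{D}^2))^{(2)}\cong\mathbb{Z}^2\quad\text{and}\quad (B_4(\mathbb{D}^2))^{(2)}\cong\mathbb{F}_2(a,b)\rtimes\Gamma_2(\mathbb{F}_2(u,v)),$$ where $a=\sigma_3\sigma_1^{-1}$ and $b=uau^{-1}=\sigma_2\sigma_3\sigma_1^{-1}\sigma_2^{-1}$ (with $u=\sigma_2\sigma_1^{-1}$, $v=\sigma_1\sigma_2\sigma_1^{-2}$).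
   Context: $\mathbb{D}^2$ is the closed $2$-disc and $B_m(\mathbb{D}^2)$ is Artin's $m$-string braid group, generated by $\sigma_1,\ldots,\sigma_{m-1}$ subject to $\sigma_i\sigma_j=\sigma_j\sigma_i$ if $|i-j|\geq 2$ and $\sigma_i\sigma_{i+1}\sigma_i=\sigma_{i+1}\sigma_i\sigma_{i+1}$ for $1\leq i\leq m-2$. Lower central series: $\Gamma_1(G)=G$, $\Gamma_{i+1}(G)=[G,\Gamma_i(G)]$; derived series: $G^{(0)}=G$, $G^{(i)}=[G^{(i-1)},G^{(i-1)}]$. $\mathbb{F}_2(x,y)$ denotes the free group of rank $2$ on $x,y$. In $N\rtimes Q$ the normal subgroup is $N$. For $m=4$, $\Gamma_2(\mathbb{F}_2(u,v))$ acts on $\mathbb{F}_2(a,b)$ as the restriction of the conjugation action of $\mathbb{F}_2(u,v)$ on $\mathbb{F}_2(a,b)$ inside $(B_4(\mathbb{D}^2))^{(1)}=\mathbb{F}_2(a,b)\rtimes\mathbb{F}_2(u,v)$, namely $uau^{-1}=b$, $ubu^{-1}=b^2a^{-1}b$, $vav^{-1}=a^{-1}b$, $vbv^{-1}=(a^{-1}b)^3a^{-2}b$. *)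

(* Defs.v *)
From HB Require Import structures.
From mathcomp Require Import all_boot all_algebra.
From mathcomp Require Import boolp classical_sets.

Set Implicit Arguments.
Unset Strict Implicit.
Unset Printing Implicit Defensive.

Local Open Scope classical_set_scope.
Local Open Scope group_scope.

Section Subgroups.
Variable G : groupType.

Record subgroup := Subgroup {
  sgset :> set G;
  sgP : group_closed [in sgset] }.

Record nsubgroup := NSubgroup {
  nsg :> subgroup;
  nsgP : forall x g, sgset nsg x -> sgset nsg (g * x * g^-1) }.

Lemma sg1 (H : subgroup) : sgset H 1.
Proof. by case: (sgP H) => /set_mem. Qed.

Lemma sgF (H : subgroup) x y : sgset H x -> sgset H y -> sgset H (x / y).
Proof.
by move=> Hx Hy; case: (sgP H) => _ HF; apply/set_mem/HF; exact: mem_set.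
Qed.

Lemma sgV (H : subgroup) x : sgset H x -> sgset H x^-1.
Proof. by move=> Hx; rewrite -[x^-1]mul1g; apply: sgF => //; exact: sg1. Qed.

Lemma sgM (H : subgroup) x y : sgset H x -> sgset H y -> sgset H (x * y).
Proof. by move=> Hx Hy; rewrite -[y]invgK; apply: sgF => //; exact: sgV. Qed.

Definition gen (S : set G) : set G := smallest [set H : set G | group_closed [in H]] S.

Lemma gen_closed (S : set G) : group_closed [in gen S].
Proof.
split; first by apply/mem_set => H [[+ _] _] => /set_mem.
move=> x y /set_mem Sx /set_mem Sy; apply/mem_set => H HS.
by apply/set_mem; apply: (HS.1.2); apply/mem_set; [exact: Sx | exact: Sy].
Qed.

Definition comm_set (H K : set G) : set G :=
  [set z | exists x y, [/\ H x, K y & z = [~ x, y]]].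

Lemma comm_normal (H K : nsubgroup) x g :
  gen (comm_set H K) x -> gen (comm_set H K) (g * x * g^-1).
Proof.
move=> Hx; pose P := [set x | gen (comm_set H K) (g * x * g^-1)].
have [G1 GF] := gen_closed (comm_set H K).
apply: (Hx P); split.
- split; first by apply/mem_set; rewrite /P /= mulg1 mulgV; exact: set_mem.
  move=> y z /set_mem Py /set_mem Pz; apply/mem_set; rewrite /P /=.
  have -> : g * (y / z) * g^-1 = (g * y * g^-1) / (g * z * g^-1).
    by rewrite !invgM invgK !mulgA mulgVK.
  by apply/set_mem/GF; exact: mem_set.
- move=> _ [y [z [Hy Kz ->]]] A [_]; apply.
  exists (g * y * g^-1), (g * z * g^-1); split; try exact: nsgP.
  by rewrite /commg /conjg !invgM !invgK !mulgA !mulgVK.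
Qed.

Definition commutator (H K : nsubgroup) : nsubgroup :=
  @NSubgroup (Subgroup (gen_closed (comm_set H K))) (@comm_normal H K).

Lemma full_closed : group_closed [in [set: G]].
Proof. by split=> [|x y _ _]; exact: mem_set. Qed.

Definition full : nsubgroup :=
  @NSubgroup (Subgroup full_closed) (fun _ _ _ => I).

Fixpoint der (i : nat) : nsubgroup :=
  if i is j.+1 then commutator (der j) (der j) else full.

(* Lower central series, indexed from 1; the value at 0 is a junk value. *)
Fixpoint lcs (i : nat) : nsubgroup :=
  match i with
  | 0 | 1 => full
  | j.+1 => commutator full (lcs j)
  end.

End Subgroups.

Section SubgroupType.
Variables (G : groupType) (H : subgroup G).

Definition sgtype := {x : G | x \in sgset H}.

HB.instance Definition _ := SubChoice.on sgtype.
HB.instance Definition _ :=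
  SubChoice_isSubGroup.Build G (fun x => x \in sgset H) sgtype (sgP H).
End SubgroupType.

Section Restriction.
Variables (G : groupType) (H : subgroup G) (K : nsubgroup G).

Definition restr_set : set (sgtype H) := [set x | sgset K (val x)].

Lemma restr_closed : group_closed [in restr_set].
Proof.
split; first by apply/mem_set; rewrite /restr_set /=; exact: sg1.
move=> x y /set_mem Kx /set_mem Ky; apply/mem_set.
exact: sgF Kx Ky.
Qed.

Lemma restr_normal x g : restr_set x -> restr_set (g * x * g^-1).
Proof. by move=> Kx; exact: (nsgP (val g) Kx). Qed.

(* [H :&: K], as a normal subgroup of the group [H]. *)
Definition restr : nsubgroup (sgtype H) :=
  @NSubgroup _ (Subgroup restr_closed) restr_normal.
End Restriction.

Section Quotient.
Variables (G : groupType) (N : nsubgroup G).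

Definition coset_rel (x y : G) : bool := `[< sgset N (x^-1 * y) >].

Lemma coset_refl : reflexive coset_rel.
Proof. by move=> x; apply/asboolP; rewrite mulVg; exact: sg1. Qed.

Lemma coset_sym : symmetric coset_rel.
Proof.
by move=> x y; apply/asboolP/asboolP => /sgV; rewrite invgM invgK.
Qed.

Lemma coset_trans : transitive coset_rel.
Proof.
move=> y x z /asboolP Nxy /asboolP Nyz; apply/asboolP.
by have := sgM Nxy Nyz; rewrite mulgA mulgK.
Qed.

Canonical coset_equiv := EquivRel coset_rel coset_refl coset_sym coset_trans.

Definition quot := {eq_quot coset_equiv}%qT.
HB.instance Definition _ := Choice.on quot.

Definition coset (x : G) : quot := \pi_quot%qT x.

Lemma cosetP x y : coset x = coset y <-> sgset N (x^-1 * y).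
Proof.
split=> [/eqP|Nxy].
  by rewrite /coset piE => /asboolP.
by apply/eqP; rewrite /coset piE; apply/asboolP.
Qed.

Definition quot_one : quot := coset 1.
Definition quot_mul (a b : quot) : quot := coset (repr a * repr b).
Definition quot_inv (a : quot) : quot := coset (repr a)^-1.

Lemma reprP x : sgset N (x^-1 * repr (coset x)).
Proof. by apply/cosetP; rewrite /coset reprK. Qed.

Lemma coset_surj (a : quot) : exists x, a = coset x.
Proof. by exists (repr a); rewrite /coset reprK. Qed.

Lemma quot_mulE x y : quot_mul (coset x) (coset y) = coset (x * y).
Proof.
symmetry; apply/cosetP; set x' := repr _; set y' := repr _.
have -> : (x * y)^-1 * (x' * y') =
          (y^-1 * (x^-1 * x') * (y^-1)^-1) * (y^-1 * y').
  by rewrite invgM invgK !mulgA mulgK.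
by apply: sgM; [apply: nsgP|]; exact: reprP.
Qed.

Lemma quot_invE x : quot_inv (coset x) = coset x^-1.
Proof.
apply/cosetP; set x' := repr _; rewrite invgK.
have -> : x' / x = x * (x^-1 * x') * x^-1 by rewrite mulgA mulgV mul1g.
by apply: nsgP; exact: reprP.
Qed.

Lemma quot_mulA : associative quot_mul.
Proof.
move=> a b c; have [[x ->] [y ->] [z ->]] :=
  And3 (coset_surj a) (coset_surj b) (coset_surj c).
by rewrite !quot_mulE mulgA.
Qed.

Lemma quot_mul1 : left_id quot_one quot_mul.
Proof. by move=> a; have [x ->] := coset_surj a; rewrite quot_mulE mul1g. Qed.

Lemma quot_1mul : right_id quot_one quot_mul.
Proof. by move=> a; have [x ->] := coset_surj a; rewrite quot_mulE mulg1. Qed.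

Lemma quot_mulV : left_inverse quot_one quot_inv quot_mul.
Proof.
by move=> a; have [x ->] := coset_surj a; rewrite quot_invE quot_mulE mulVg.
Qed.

Lemma quot_Vmul : right_inverse quot_one quot_inv quot_mul.
Proof.
by move=> a; have [x ->] := coset_surj a; rewrite quot_invE quot_mulE mulgV.
Qed.

HB.instance Definition _ := isGroup.Build quot
  quot_mulA quot_mul1 quot_1mul quot_mulV quot_Vmul.

Lemma cosetM : {morph coset : x y / x * y}.
Proof. by move=> x y; rewrite -quot_mulE. Qed.
End Quotient.

Section Presentation.
Variable X : choiceType.

(* [(x, true)] is the letter x and [(x, false)] its formal inverse. *)
Definition word := seq (X * bool).

Definition word_inv (w : word) : word := [seq (l.1, ~~ l.2) | l <- rev w].

Variable R : word -> word -> Prop.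

(* The least congruence making formal inverses inverses and identifying the
   two sides of each defining relation [R w w']. *)
Inductive pres_eq : word -> word -> Prop :=
| PresRefl w : pres_eq w w
| PresSym w w' : pres_eq w w' -> pres_eq w' w
| PresTrans w2 w1 w3 : pres_eq w1 w2 -> pres_eq w2 w3 -> pres_eq w1 w3
| PresCat w1 w1' w2 w2' :
    pres_eq w1 w1' -> pres_eq w2 w2' -> pres_eq (w1 ++ w2) (w1' ++ w2')
| PresCancel x b : pres_eq [:: (x, b); (x, ~~ b)] [::]
| PresRel w w' : R w w' -> pres_eq w w'.

Definition pres_rel (w w' : word) : bool := `[< pres_eq w w' >].

Lemma pres_rel_refl : reflexive pres_rel.
Proof. by move=> w; apply/asboolP; exact: PresRefl. Qed.

Lemma pres_rel_sym : symmetric pres_rel.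
Proof. by move=> w w'; apply/asboolP/asboolP; exact: PresSym. Qed.

Lemma pres_rel_trans : transitive pres_rel.
Proof.
by move=> y x z /asboolP xy /asboolP yz; apply/asboolP; exact: PresTrans yz.
Qed.

Canonical pres_equiv :=
  EquivRel pres_rel pres_rel_refl pres_rel_sym pres_rel_trans.

Definition pgroup := {eq_quot pres_equiv}%qT.
HB.instance Definition _ := Choice.on pgroup.

Definition pcls (w : word) : pgroup := \pi_pgroup%qT w.

Lemma pclsP w w' : pcls w = pcls w' <-> pres_eq w w'.
Proof.
split=> [/eqP|ww'].
  by rewrite /pcls piE => /asboolP.
by apply/eqP; rewrite /pcls piE; apply/asboolP.
Qed.

Lemma pres_reprP w : pres_eq (repr (pcls w)) w.
Proof. by apply/pclsP; rewrite /pcls reprK. Qed.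

Lemma pcls_surj (a : pgroup) : exists w, a = pcls w.
Proof. by exists (repr a); rewrite /pcls reprK. Qed.

Lemma pres_eq_invl w : pres_eq (word_inv w ++ w) [::].
Proof.
elim: w => [|[x b] w IH]; first exact: PresRefl.
rewrite /word_inv rev_cons map_rcons -cats1 -catA /=.
apply: PresTrans IH; apply: PresCat; first exact: PresRefl.
have := PresCat (PresCancel x (~~ b)) (PresRefl w); rewrite negbK; exact.
Qed.

Lemma word_invK : involutive word_inv.
Proof.
move=> w; rewrite /word_inv -map_rev revK -map_comp.
by rewrite -[RHS]map_id; apply: eq_map => -[x b] /=; rewrite negbK.
Qed.

Lemma pres_eq_invr w : pres_eq (w ++ word_inv w) [::].
Proof. by have := pres_eq_invl (word_inv w); rewrite word_invK. Qed.

Lemma pres_eq_inv w w' : pres_eq w w' -> pres_eq (word_inv w) (word_inv w').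
Proof.
move=> ww'; apply: (@PresTrans (word_inv w ++ (w' ++ word_inv w'))).
  apply: PresSym; rewrite -{2}[word_inv w]cats0.
  by apply: PresCat (PresRefl _) (pres_eq_invr w').
rewrite catA -{2}[word_inv w']cat0s; apply: PresCat (PresRefl _).
apply: PresTrans (pres_eq_invl w).
by apply: PresCat (PresRefl _) (PresSym ww').
Qed.

Definition pgroup_one : pgroup := pcls [::].
Definition pgroup_mul (a b : pgroup) : pgroup := pcls (repr a ++ repr b).
Definition pgroup_inv (a : pgroup) : pgroup := pcls (word_inv (repr a)).

Lemma pgroup_mulE w w' : pgroup_mul (pcls w) (pcls w') = pcls (w ++ w').
Proof. by apply/pclsP; apply: PresCat; exact: pres_reprP. Qed.

Lemma pgroup_invE w : pgroup_inv (pcls w) = pcls (word_inv w).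
Proof. by apply/pclsP; apply: pres_eq_inv; exact: pres_reprP. Qed.

Lemma pgroup_mulA : associative pgroup_mul.
Proof.
move=> a b c; have [[x ->] [y ->] [z ->]] :=
  And3 (pcls_surj a) (pcls_surj b) (pcls_surj c).
by rewrite !pgroup_mulE catA.
Qed.

Lemma pgroup_mul1 : left_id pgroup_one pgroup_mul.
Proof. by move=> a; have [w ->] := pcls_surj a; rewrite pgroup_mulE. Qed.

Lemma pgroup_1mul : right_id pgroup_one pgroup_mul.
Proof. by move=> a; have [w ->] := pcls_surj a; rewrite pgroup_mulE cats0. Qed.

Lemma pgroup_mulV : left_inverse pgroup_one pgroup_inv pgroup_mul.
Proof.
move=> a; have [w ->] := pcls_surj a; rewrite pgroup_invE pgroup_mulE.
by apply/pclsP; exact: pres_eq_invl.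
Qed.

Lemma pgroup_Vmul : right_inverse pgroup_one pgroup_inv pgroup_mul.
Proof.
move=> a; have [w ->] := pcls_surj a; rewrite pgroup_invE pgroup_mulE.
by apply/pclsP; exact: pres_eq_invr.
Qed.

HB.instance Definition _ := isGroup.Build pgroup
  pgroup_mulA pgroup_mul1 pgroup_1mul pgroup_mulV pgroup_Vmul.

Lemma pclsM w w' : pcls (w ++ w') = pcls w * pcls w'.
Proof. by rewrite -pgroup_mulE. Qed.

Definition pgen (x : X) : pgroup := pcls [:: (x, true)].

Variables (G : groupType) (f : X -> G).

Definition word_eval (w : word) : G :=
  \prod_(l <- w) (if l.2 then f l.1 else (f l.1)^-1).

(* A homomorphism only when [f] respects the relations [R], which is automatic
   for free groups. *)
Definition pres_hom (a : pgroup) : G := word_eval (repr a).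

Hypothesis fR : forall w w', R w w' -> word_eval w = word_eval w'.

Lemma word_eval_eq w w' : pres_eq w w' -> word_eval w = word_eval w'.
Proof.
elim=> //= {w w'} [w2 w1 w3 _ -> _ ->//|w1 w1' w2 w2' _ E1 _ E2|x b].
  by rewrite /word_eval !big_cat; congr (_ * _).
rewrite /word_eval !big_cons big_nil mulg1 /=.
by case: b; rewrite /= ?mulgV ?mulVg.
Qed.

Lemma pres_hom_cls w : pres_hom (pcls w) = word_eval w.
Proof. by apply: word_eval_eq; exact: pres_reprP. Qed.

Lemma pres_homM : {morph pres_hom : a b / a * b}.
Proof.
move=> a b; have [[w ->] [w' ->]] := conj (pcls_surj a) (pcls_surj b).
by rewrite -pclsM !pres_hom_cls /word_eval big_cat.
Qed.

Lemma pres_hom_gen x : pres_hom (pgen x) = f x.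
Proof. by rewrite pres_hom_cls /word_eval big_cons big_nil mulg1. Qed.
End Presentation.

Definition free (X : choiceType) := @pgroup X (fun _ _ => False).
HB.instance Definition _ (X : choiceType) := Group.on (free X).

Definition F2 := free bool.
HB.instance Definition _ := Group.on F2.
Definition F2x : F2 := pgen _ true.
Definition F2y : F2 := pgen _ false.

Definition F2_hom (G : groupType) (g h : G) : F2 -> G :=
  pres_hom (fun b : bool => if b then g else h).

Lemma F2_homM (G : groupType) (g h : G) : {morph F2_hom g h : a b / a * b}.
Proof. exact: pres_homM. Qed.

Lemma F2_hom_x (G : groupType) (g h : G) : F2_hom g h F2x = g.
Proof. exact: pres_hom_gen. Qed.

Lemma F2_hom_y (G : groupType) (g h : G) : F2_hom g h F2y = h.
Proof. exact: pres_hom_gen. Qed.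

Section Braid.
Variable m : nat.

Definition bgen := {i : nat | 0 < i < m}.

Definition bletter (i : bgen) : bgen * bool := (i, true).

Inductive braid_rel : word bgen -> word bgen -> Prop :=
| BraidFar (i j : bgen) : (val i + 2 <= val j) || (val j + 2 <= val i) ->
    braid_rel [:: bletter i; bletter j] [:: bletter j; bletter i]
| BraidNear (i j : bgen) : val j = (val i).+1 ->
    braid_rel [:: bletter i; bletter j; bletter i]
              [:: bletter j; bletter i; bletter j].

Definition braid := pgroup braid_rel.
HB.instance Definition _ := Group.on braid.

(* The generators are numbered from 1 to [m - 1]. *)
Definition sigma (i : nat) (im : 0 < i < m) : braid :=
  pgen _ (exist (fun i => 0 < i < m) i im).
End Braid.

(* Each [act q] is bijective by [act1] and [actA], hence an automorphism. *)
Record gact (Q N : groupType) := GAct {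
  act :> Q -> N -> N;
  act1 : forall n, act 1 n = n;
  actA : forall p q n, act (p * q) n = act p (act q n);
  actM : forall q n n', act q (n * n') = act q n * act q n' }.

Lemma gact_one (Q N : groupType) (al : gact Q N) q : al q 1 = 1.
Proof. by apply: (@mulgI _ (al q 1)); rewrite -actM !mulg1. Qed.

Definition gact_restr (Q N : groupType) (al : gact Q N) (H : subgroup Q) :
  gact (sgtype H) N.
Proof.
apply: (@GAct _ _ (fun (q : sgtype H) n => al (val q) n)).
- by move=> n; rewrite val1 act1.
- by move=> p q n; rewrite valM actA.
- by move=> q n n'; rewrite actM.
Defined.

(* The external semidirect product of the normal factor [N] by [Q].  The action
   occurs in the type only so that the group structure can be inferred. *)
Definition sdprod (Q N : groupType) (_ : gact Q N) : Type := (N * Q)%type.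

Section SemidirectProduct.
Variables (Q N : groupType) (al : gact Q N).
Local Notation sdprod := (sdprod al).

HB.instance Definition _ := Choice.on sdprod.

Definition sd_one : sdprod := (1, 1).
Definition sd_mul (a b : sdprod) : sdprod :=
  (a.1 * al a.2 b.1, a.2 * b.2).
Definition sd_inv (a : sdprod) : sdprod := (al a.2^-1 a.1^-1, a.2^-1).

Lemma sd_mulA : associative sd_mul.
Proof. by move=> a b c; rewrite /sd_mul /= actM actA !mulgA. Qed.

Lemma sd_mul1 : left_id sd_one sd_mul.
Proof. by case=> n q; rewrite /sd_mul /= act1 !mul1g. Qed.

Lemma sd_1mul : right_id sd_one sd_mul.
Proof. by case=> n q; rewrite /sd_mul /= gact_one !mulg1. Qed.

Lemma sd_mulV : left_inverse sd_one sd_inv sd_mul.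
Proof. by case=> n q; rewrite /sd_mul /sd_inv /= -actM !mulVg gact_one. Qed.

Lemma sd_Vmul : right_inverse sd_one sd_inv sd_mul.
Proof. by case=> n q; rewrite /sd_mul /sd_inv /= -actA !mulgV act1 mulgV. Qed.

HB.instance Definition _ := isGroup.Build sdprod
  sd_mulA sd_mul1 sd_1mul sd_mulV sd_Vmul.
End SemidirectProduct.

Definition giso (G H : groupType) (f : G -> H) : Prop :=
  {morph f : x y / x * y} /\ bijective f.

Definition isog (G H : groupType) : Prop := exists f : G -> H, giso f.

(* Additive groups viewed as [groupType]s: the identity is [0%R] and the
   product is [+%R]. *)
Notation Z1 := (Algebra.to_multiplicative int).
Notation Z2 := (Algebra.to_multiplicative (int * int)%type).
Definition Zgen : Z1 := 1%R : int.
Definition Ze1 : Z2 := (1%R, 0%R) : int * int.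
Definition Ze2 : Z2 := (0%R, 1%R) : int * int.

(* Main.v *)
Require Import Defs.
From HB Require Import structures.
From mathcomp Require Import all_boot all_algebra.
From mathcomp Require Import boolp classical_sets.
From mathcomp Require Import zify.

(* Part (a): modulo Γ_3 the elements of Γ_2 are central, and all the σ_i agree
   modulo Γ_2; hence the σ_i commute modulo Γ_3, that is Γ_2 ⊆ Γ_3.

   Parts (c) and (d) rest on explicit models of the braid groups:
     B_3 ≅ F_2(u, v) ⋊ Z,    where σ_1 acts by u ↦ v, v ↦ u^-1 v;
     B_4 ≅ F_2(a, b) ⋊ B_3,  where σ_1 acts by a ↦ a, b ↦ a^-1 b and
                             σ_2 acts by a ↦ b, b ↦ b a^-1 b.
   In both cases the generators of the braid group satisfy their relations in
   the model, and a ⋊-compatible pair of homomorphisms gives the inverse.  The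
   derived subgroup of B_3 is then the factor F_2(u, v), and its second derived
   subgroup is the preimage of 1 under the Abelianisation of that factor.  In
   B_4 the factor F_2(a, b) already lies in the second derived subgroup, as u
   and v act on its Abelianisation with no coinvariants; thus B_4^(1) and
   B_4^(2) are the preimages of B_3^(1) and B_3^(2). *)

Set Implicit Arguments.
Unset Strict Implicit.
Unset Printing Implicit Defensive.

Import GRing.Theory.
Local Open Scope classical_set_scope.
Local Open Scope group_scope.

(* Reduces a group word to its left-associated free normal form. *)
Definition gnorm (G : groupType) := (@invgM G, @invgK G, @invg1 G, @mul1g G,
  @mulg1 G, @mulgA G, @mulgV G, @mulVg G, @mulgK G, @mulgVK G).

Lemma inj_surj_bij (A B : Type) (f : A -> B) :
  injective f -> (forall y, exists x, f x = y) -> bijective f.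
Proof.
move=> finj fsurj; exists (fun y => projT1 (cid (fsurj y))) => x.
  by apply: finj; case: cid.
by case: cid.
Qed.

(** * Commutator subgroups and quotients *)

Section Morphism.
Variables (G H : groupType) (f : G -> H).
Hypothesis fM : {morph f : x y / x * y}.

Lemma morph_one : f 1 = 1.
Proof. by apply: (@mulgI _ (f 1)); rewrite -fM !mulg1. Qed.

Lemma morph_inv x : f x^-1 = (f x)^-1.
Proof. by apply: (@mulgI _ (f x)); rewrite -fM !mulgV morph_one. Qed.

Lemma morph_div x y : f (x / y) = f x / f y.
Proof. by rewrite fM morph_inv. Qed.

Lemma morph_comm x y : f [~ x, y] = [~ f x, f y].
Proof. by rewrite /commg /conjg !fM !morph_inv. Qed.

End Morphism.

(** Induction principle for [gen]. The target [A] is a bare set with closure conditions, so that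
    preimages and images under homomorphisms qualify directly. *)
Lemma gen_sub (G : groupType) (S A : set G) :
  A 1 -> (forall x y, A x -> A y -> A (x / y)) -> S `<=` A -> gen S `<=` A.
Proof.
move=> A1 AF SA x; apply; split=> //; split; first exact: mem_set.
by move=> y z /set_mem Ay /set_mem Az; apply/mem_set; exact: AF.
Qed.

Lemma gen_subsg (G : groupType) (S : set G) (H : subgroup G) :
  S `<=` sgset H -> gen S `<=` sgset H.
Proof. by apply: gen_sub; [exact: sg1 | move=> x y; exact: sgF]. Qed.

Lemma mem_commutator (G : groupType) (H K : nsubgroup G) x y :
  sgset H x -> sgset K y -> sgset (commutator H K) [~ x, y].
Proof. by move=> Hx Ky A [_]; apply; exists x, y. Qed.

Lemma derS_mem (G : groupType) i x y :
  sgset (der G i) x -> sgset (der G i) y -> sgset (der G i.+1) [~ x, y].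
Proof. exact: mem_commutator. Qed.

(** The offsets [i] and [j] let the induction start wherever an inclusion is known; for F_2 inside
    B_3 the two series are shifted by one. *)
Lemma der_homo (G H : groupType) (f : G -> H) (i j : nat) :
  {morph f : x y / x * y} -> f @` sgset (der G j) `<=` sgset (der H i) ->
  forall k, f @` sgset (der G (k + j)) `<=` sgset (der H (k + i)).
Proof.
move=> fM Hij; elim=> [//|k IH] _ [x Gx <-]; rewrite addSn; move: x Gx.
apply: (@gen_sub _ _ (f @^-1` sgset (der H (k + i).+1))).
- by rewrite /preimage /mkset (morph_one fM); exact: sg1.
- by rewrite /preimage /mkset => x y; rewrite (morph_div fM); exact: sgF.
- move=> _ [x [y [Gx Gy ->]]]; rewrite /preimage /mkset (morph_comm fM).
  by apply: derS_mem; apply: IH; [exists x | exists y].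
Qed.

Lemma der_image (G H : groupType) (f : G -> H) (i j : nat) :
  {morph f : x y / x * y} -> sgset (der H i) `<=` f @` sgset (der G j) ->
  forall k, sgset (der H (k + i)) `<=` f @` sgset (der G (k + j)).
Proof.
move=> fM Hij; elim=> [//|k IH].
apply: gen_sub => [|_ _ [x Gx <-] [y Gy <-]|].
- by exists 1; [exact: sg1 | exact: morph_one].
- by exists (x / y); [exact: sgF | exact: morph_div].
- move=> _ [y [z [/IH [a Ga <-] /IH [b Gb <-] ->]]].
  by exists [~ a, b]; [exact: derS_mem | exact: morph_comm].
Qed.

Lemma der1_abelian (A : groupType) :
  (forall x y : A, commute x y) -> sgset (der A 1) `<=` [set 1].
Proof.
move=> AC; apply: gen_sub => //= [_ _ -> ->|_ [x [y [_ _ ->]]]].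
  by rewrite mulgV.
by apply/eqP/commgP.
Qed.

Lemma morph_der1 (G A : groupType) (f : G -> A) x :
  {morph f : x y / x * y} -> (forall y z : A, commute y z) ->
  sgset (der G 1) x -> f x = 1.
Proof.
move=> fM Acomm Gx; apply: (der1_abelian Acomm).
by apply: (@der_homo _ _ _ 0 0 fM _ 1); last by exists x.
Qed.

Lemma der1_conj (G : groupType) (g x : G) : sgset (der G 1) (g * x * g^-1 / x).
Proof.
have -> : g * x * g^-1 / x = [~ g^-1, x^-1].
  by rewrite /commg /conjg !invgK !mulgA.
exact: derS_mem.
Qed.

(** The braid relation makes [y] the conjugate of [x] by [x * y]. *)
Lemma der1_braided (G : groupType) (x y : G) :
  x * y * x = y * x * y -> sgset (der G 1) (y / x).
Proof.
move=> xy; have <- : (x * y) * x * (x * y)^-1 = y by rewrite xy !gnorm.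
exact: der1_conj.
Qed.

Lemma coset1P (G : groupType) (N : nsubgroup G) x : coset N x = 1 <-> sgset N x.
Proof.
have := cosetP N 1 x; rewrite invg1 mul1g => <-.
by split=> [->//|<-].
Qed.

Lemma coset_commute (G : groupType) (N : nsubgroup G) x y :
  sgset N [~ x, y] -> commute (coset N x) (coset N y).
Proof.
move=> Nxy; apply/commgP/eqP; rewrite -(morph_comm (@cosetM _ N)).
exact/coset1P.
Qed.

Lemma coset_der1_commute (G : groupType) (p q : quot (der G 1)) : commute p q.
Proof.
have [[x ->] [y ->]] := conj (coset_surj p) (coset_surj q).
by apply: coset_commute; exact: derS_mem.
Qed.

(** First isomorphism theorem, keeping the value on cosets so that the images of named elements can
    be read off. *)
Lemma quot_giso (G A : groupType) (N : nsubgroup G) (h : G -> A) :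
  {morph h : x y / x * y} -> (forall y, exists x, h x = y) ->
  (forall x, sgset N x <-> h x = 1) ->
  exists f : quot N -> A, giso f /\ forall x, f (coset N x) = h x.
Proof.
move=> hM hsurj Nh; exists (fun a => h (repr a)).
(* The chosen representative differs from [x] by an element of the kernel. *)
have hE x : h (repr (coset N x)) = h x.
  have /Nh := reprP N x; rewrite hM (morph_inv hM) => /mulg1_eq.
  by rewrite invgK.
split=> //; split.
  move=> a b; have [[x ->] [y ->]] := conj (coset_surj a) (coset_surj b).
  by rewrite -cosetM !hE hM.
apply: inj_surj_bij => [a b|y]; last first.
  by have [x <-] := hsurj y; exists (coset N x).
have [[x ->] [z ->]] := conj (coset_surj a) (coset_surj b).
rewrite !hE => xz; apply/cosetP/Nh.
by rewrite hM (morph_inv hM) xz mulVg.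
Qed.

Lemma sgtype_giso (A G : groupType) (H : subgroup G) (g : A -> G) :
  {morph g : x y / x * y} -> injective g -> sgset H = range g ->
  exists f : A -> sgtype H, giso f /\ forall x, val (f x) = g x.
Proof.
move=> gM ginj Hg.
have gH x : g x \in sgset H by apply/mem_set; rewrite Hg; exists x.
exists (fun x => exist _ (g x) (gH x)); split=> //; split.
  by move=> x y; apply: val_inj; rewrite valM /= gM.
apply: inj_surj_bij => [x y /(congr1 val)|[y Hy]]; first exact: ginj.
have : range g y by rewrite -Hg; exact: set_mem.
case=> x _ gx.
by exists x; apply: val_inj.
Qed.

(** * Presented and free groups *)

Section PresentedGroup.
Variables (X : choiceType) (R : word X -> word X -> Prop).

Lemma pgroup_ind (P : pgroup R -> Prop) :
  P 1 -> (forall a b, P a -> P b -> P (a * b)) -> (forall a, P a -> P a^-1) ->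
  (forall x, P (pgen R x)) -> forall a, P a.
Proof.
move=> P1 PM PV Pgen a; have [w ->] := pcls_surj a.
elim: w => [//|[x b] w IH].
rewrite -cat1s pclsM; apply: PM => //; case: b; first exact: Pgen.
suff -> : pcls R [:: (x, false)] = (pgen R x)^-1 by exact: PV.
by apply: (@mulgI _ (pgen R x)); rewrite mulgV -pclsM; apply/pclsP/PresCancel.
Qed.

Lemma pgroup_hom_ext (G : groupType) (f g : pgroup R -> G) :
  {morph f : x y / x * y} -> {morph g : x y / x * y} ->
  (forall x, f (pgen R x) = g (pgen R x)) -> f =1 g.
Proof.
move=> fM gM fg; apply: pgroup_ind => // [|a b fa fb|a fa].
- by rewrite !morph_one.
- by rewrite fM gM fa fb.
- by rewrite !morph_inv // fa.
Qed.

Lemma pgroup_abelian (G : groupType) (f : pgroup R -> G) :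
  {morph f : x y / x * y} ->
  (forall x y, commute (f (pgen R x)) (f (pgen R y))) ->
  forall a b, commute (f a) (f b).
Proof.
move=> fM fC a b; elim/pgroup_ind: b => [|b c|b|y].
- by rewrite morph_one //; exact: commute1.
- by rewrite fM; exact: commuteM.
- by rewrite morph_inv //; exact: commuteV.
apply: commute_sym; elim/pgroup_ind: a => [|b c|b|x].
- by rewrite morph_one //; exact: commute1.
- by rewrite fM; exact: commuteM.
- by rewrite morph_inv //; exact: commuteV.
- exact: fC.
Qed.
End PresentedGroup.

Lemma F2_hom_ext (G : groupType) (f g : F2 -> G) :
  {morph f : x y / x * y} -> {morph g : x y / x * y} ->
  f F2x = g F2x -> f F2y = g F2y -> f =1 g.
Proof. by move=> fM gM fgx fgy; apply: pgroup_hom_ext => // -[]. Qed.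

Lemma F2_hom_comp (G H : groupType) (f : G -> H) (x y : G) :
  {morph f : x y / x * y} ->
  forall w, f (F2_hom x y w) = F2_hom (f x) (f y) w.
Proof.
move=> fM; apply: F2_hom_ext => [p q|||]; rewrite ?F2_homM ?fM //.
- exact: F2_homM.
- by rewrite !F2_hom_x.
- by rewrite !F2_hom_y.
Qed.

Lemma F2_hom_id w : F2_hom F2x F2y w = w.
Proof.
move: w; apply: F2_hom_ext => //; first exact: F2_homM.
- exact: F2_hom_x.
- exact: F2_hom_y.
Qed.

(** * Automorphisms and semidirect products *)

Section Automorphisms.
Variable N : groupType.

(** Automorphisms carry their inverse as data. Being a [groupType], they can be the target of maps
    out of presented groups, so that an action is obtained by checking the defining relations. *)
Record aut := Aut {
  aut_fun :> N -> N;
  aut_inv : N -> N;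
  autK : cancel aut_fun aut_inv;
  autVK : cancel aut_inv aut_fun;
  autM : {morph aut_fun : x y / x * y} }.

Lemma aut_eq (f g : aut) : f =1 g -> f = g.
Proof.
case: f g => [f f' fK f'K fM] [g g' gK g'K gM] /= /funext fg.
case: _ / fg in gK g'K gM *.
have fg' : f' = g' by apply/funext => x; rewrite -[x in LHS]g'K fK.
case: _ / fg' in gK g'K *.
by congr Aut; exact: Prop_irrelevance.
Qed.

HB.instance Definition _ := gen_eqMixin aut.
HB.instance Definition _ := gen_choiceMixin aut.

Definition aut_one : aut :=
  @Aut id id (fun=> erefl) (fun=> erefl) (fun _ _ => erefl).

Definition aut_mul (f g : aut) : aut.
Proof.
apply: (@Aut (f \o g) (aut_inv g \o aut_inv f)).
- exact: can_comp (@autK f) (@autK g).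
- exact: can_comp (@autVK g) (@autVK f).
- by move=> x y /=; rewrite !autM.
Defined.

Definition aut_opp (f : aut) : aut.
Proof.
apply: (@Aut (aut_inv f) f (@autVK f) (@autK f)).
by move=> x y; apply: (can_inj (@autK f)); rewrite autM !autVK.
Defined.

Lemma aut_mulA : associative aut_mul.
Proof. by move=> f g h; exact: aut_eq. Qed.

Lemma aut_mul1 : left_id aut_one aut_mul.
Proof. by move=> f; exact: aut_eq. Qed.

Lemma aut_1mul : right_id aut_one aut_mul.
Proof. by move=> f; exact: aut_eq. Qed.

Lemma aut_mulV : left_inverse aut_one aut_opp aut_mul.
Proof. by move=> f; apply: aut_eq => x /=; rewrite autK. Qed.
Lemma aut_Vmul : right_inverse aut_one aut_opp aut_mul.
Proof. by move=> f; apply: aut_eq => x /=; rewrite autVK. Qed.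

HB.instance Definition _ := isGroup.Build aut
  aut_mulA aut_mul1 aut_1mul aut_mulV aut_Vmul.

Lemma aut_mulE (f g : aut) x : (f * g) x = f (g x). Proof. by []. Qed.

Definition gact_of_hom (Q : groupType) (h : Q -> aut)
  (hM : {morph h : x y / x * y}) : gact Q N.
Proof.
apply: (@GAct Q N (fun q n => h q n)).
- by move=> n; rewrite (morph_one hM).
- by move=> p q n; rewrite hM.
- by move=> q; exact: autM.
Defined.
End Automorphisms.

Lemma sdprodME (Q N : groupType) (al : gact Q N) (n n' : N) (q q' : Q) :
  ((n, q) : sdprod al) * ((n', q') : sdprod al) =
    (n * al q n', q * q').
Proof. by []. Qed.

Section SemidirectHom.
Variables (Q N G : groupType) (al : gact Q N) (f : N -> G) (h : Q -> G).
Hypotheses (fM : {morph f : x y / x * y}) (hM : {morph h : x y / x * y}).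
Hypothesis fh : forall q n, f (al q n) = h q * f n * (h q)^-1.

(** By [fh], conjugation by [h q] realises the action of [q] on the image of [f], so [h q] can be
    moved past values of [f]. *)
Lemma sdprod_homM :
  {morph (fun x : sdprod al => f x.1 * h x.2) : x y / x * y}.
Proof. by case=> [n q] [n' q']; rewrite sdprodME /= fM hM fh !gnorm. Qed.
End SemidirectHom.

(** * Integer powers and the Abelianisation of F_2 *)

Section IntegerPowers.
Variable G : groupType.

(* The exponents are taken in the multiplicative group Z1, so that [zpow g] is
   a homomorphism. *)
Definition zpow (g : G) (n : Z1) : G :=
  match (n : int) with Posz k => g ^+ k | Negz k => g ^- k.+1 end.

Lemma zpowS g (n : int) : zpow g (n + 1)%R = zpow g n * g.
Proof.
case: n => [k|[|k]]; first by rewrite -PoszD addn1; exact: expgSr.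
  by rewrite /= expg1 mulVg.
have -> : (Negz k.+1 + 1 = Negz k :> int)%R by rewrite !NegzE; lia.
by rewrite /= [g ^+ k.+2]expgS invgM mulgVK.
Qed.

Lemma zpowM g : {morph zpow g : m n / m * n}.
Proof.
move=> m n; change (zpow g ((m : int) + (n : int))%R = zpow g m * zpow g n).
elim: n => [|n IH|n IH]; first by rewrite addr0 /= mulg1.
  by rewrite -addn1 PoszD addrA !zpowS IH mulgA.
(* Downward step: multiplying by [g] on the right raises both exponents by one, back to the
   induction hypothesis. *)
apply: (@mulIg _ g); rewrite -mulgA -!zpowS.
have -> : (- n.+1%:Z + 1 = - n%:Z)%R by lia.
by rewrite -IH; congr zpow; lia.
Qed.
End IntegerPowers.

Section TwoPowers.
Variables (G : groupType) (GC : forall x y : G, commute x y).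

Lemma zpow2M (p q : G) :
  {morph (fun x : Z2 => zpow p (x.1 : int) * zpow q (x.2 : int)) : x y / x * y}.
Proof.
move=> [m n] [m' n'] /=.
change (zpow p ((m : Z1) * (m' : Z1)) * zpow q ((n : Z1) * (n' : Z1)) =
  zpow p m * zpow q n * (zpow p m' * zpow q n')).
by rewrite !zpowM -!mulgA; congr (_ * _); rewrite !mulgA (GC (zpow p m')).
Qed.
End TwoPowers.

Lemma Z2_abelian (x y : Z2) : commute x y.
Proof. exact: (@GRing.addrC (int * int)%type). Qed.

Lemma Z1_abelian (x y : Z1) : commute x y.
Proof. exact: (@GRing.addrC int). Qed.

Definition F2_ab : F2 -> Z2 := F2_hom Ze1 Ze2.

(** For the kernel to lie in the derived subgroup, the projection onto the quotient is factored
    through [F2_ab]: the quotient is Abelian, and the two maps agree on generators. *)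
Lemma F2_ab_ker w : sgset (der F2 1) w <-> F2_ab w = 1.
Proof.
split=> [|abw]; first exact: (morph_der1 (F2_homM _ _) Z2_abelian).
apply/coset1P.
pose h (z : Z2) := zpow (coset (der F2 1) F2x) (z.1 : int) *
  zpow (coset (der F2 1) F2y) (z.2 : int).
have hM := zpow2M (@coset_der1_commute F2) (coset (der F2 1) F2x)
  (coset (der F2 1) F2y).
have -> : coset (der F2 1) w = h (F2_ab w).
  move: w {abw}; apply: F2_hom_ext.
  - exact: cosetM.
  - by move=> x y; rewrite /F2_ab F2_homM; exact: hM.
  - by rewrite /F2_ab F2_hom_x /h /= mulg1.
  - by rewrite /F2_ab F2_hom_y /h /= mul1g.
by rewrite abw /h mulg1.
Qed.

Lemma commutator_sub (G : groupType) (H H' K K' : nsubgroup G) :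
  sgset H `<=` sgset H' -> sgset K `<=` sgset K' ->
  sgset (commutator H K) `<=` sgset (commutator H' K').
Proof.
move=> HH' KK'; apply: gen_subsg => _ [x [y [/HH' Hx /KK' Ky ->]]].
exact: mem_commutator.
Qed.

Lemma commutator_eq (G : groupType) (H H' K K' : nsubgroup G) :
  sgset H = sgset H' -> sgset K = sgset K' ->
  sgset (commutator H K) = sgset (commutator H' K').
Proof. by move=> eH eK; rewrite /= eH eK. Qed.

(** * Braid groups *)

Section Braid.
Variable m : nat.

Lemma pgen_braid (i j : bgen m) : val j = (val i).+1 ->
  pgen (@braid_rel m) i * pgen _ j * pgen _ i =
  pgen _ j * pgen _ i * pgen _ j.
Proof.
move=> ij; rewrite -!(pclsM _ [:: _] [:: _]) -!(pclsM _ [:: _; _] [:: _]).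
by apply/pclsP/PresRel; exact: (BraidNear ij).
Qed.

(** Neighbouring generators agree modulo the derived subgroup by [der1_braided]; the general case
    telescopes, by induction on the distance of the indices. *)
Lemma pgen_der1 (i j : bgen m) :
  sgset (der (braid m) 1) (pgen (@braid_rel m) i / pgen _ j).
Proof.
wlog ij : i j / (val i <= val j)%N.
  move=> H; case: (leqP (val i) (val j)) => [|/ltnW] /H // /sgV.
  by rewrite invgF.
have [k] := ubnP (val j - val i)%N; elim: k => // k IH in i ij *.
rewrite ltnS => jik; have [eij|neij] := eqVneq (val i) (val j).
  by rewrite (val_inj eij) mulgV; exact: sg1.
have lt_ij : (val i < val j)%N by rewrite ltn_neqAle neij.
have i1P : (0 < (val i).+1 < m)%N.
  by have /andP[_] := valP j; exact: leq_ltn_trans.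
pose i1 : bgen m := exist _ (val i).+1 i1P.
rewrite -[X in X / _](mulgVK (pgen _ i1)) -mulgA; apply: sgM.
  by rewrite -invgF; apply: sgV; apply: der1_braided; exact: pgen_braid.
by apply: IH => //=; rewrite subnS prednK // subn_gt0.
Qed.

Lemma lcs23 : sgset (lcs (braid m) 3) = sgset (lcs (braid m) 2).
Proof.
apply/seteqP; split; first exact: commutator_sub.
pose c := coset (lcs (braid m) 3).
have cM : {morph c : x y / x * y} := @cosetM _ _.
have c2 x y : sgset (lcs (braid m) 2) y -> commute (c x) (c y).
  by move=> y2; apply: coset_commute; exact: mem_commutator.
apply: gen_subsg => _ [x [y [_ _ ->]]].
apply/coset1P; rewrite -/(c _) (morph_comm cM); apply/eqP/commgP.
apply: (pgroup_abelian cM) => i j.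
(* In σ_i = (σ_i σ_j^-1) σ_j the first factor is central modulo Γ_3. [pgen_der1] applies since
   [der _ 1] and [lcs _ 2] unfold to the same commutator. *)
rewrite -[pgen _ i](mulgVK (pgen _ j)) cM; apply/commute_sym/commuteM => //.
by apply: c2; exact: pgen_der1.
Qed.

(** Taking commutators with the whole group propagates the equality of Γ_3 and Γ_2 upwards. *)
Lemma lcs_braid (s : nat) : (3 <= s)%N ->
  sgset (lcs (braid m) s) = sgset (lcs (braid m) 2).
Proof.
case: s => [//|[//|[//|s]]] _; elim: s => [|s IH]; first exact: lcs23.
by rewrite -[RHS]lcs23; apply: commutator_eq.
Qed.

(** There is at most one generator, so the group is Abelian; all later terms lie in the first
    derived subgroup. *)
Lemma der_braid2 (s : nat) : (m <= 2)%N -> (0 < s)%N ->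
  sgset (der (braid m) s) = [set 1].
Proof.
move=> m2; case: s => // s _; apply/seteqP; split; last first.
  by move=> _ ->; exact: sg1.
have abel (x y : braid m) : commute x y.
  apply: (@pgroup_abelian _ _ _ id) => // i j.
  suff -> : i = j by exact: commute_refl.
  by apply: val_inj; case: i j => [i Pi] [j Pj] /=; lia.
by apply: subset_trans (der1_abelian abel); exact: commutator_sub.
Qed.
End Braid.

Section ThreeStrands.
Notation s1 := (@sigma 3 1 isT).
Notation s2 := (@sigma 3 2 isT).

Lemma braid3_rel : s1 * s2 * s1 = s2 * s1 * s2.
Proof. exact: pgen_braid. Qed.

Lemma bgen3_ind (P : braid 3 -> Prop) :
  P s1 -> P s2 -> forall i, P (pgen (@braid_rel 3) i).
Proof.
(* Only the indices 1 and 2 survive; proofs of boolean equalities being irrelevant, their bounds can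
   be taken to be [isT]. *)
move=> P1 P2 [[//|[|[|//]]] i_lt].
- by rewrite (eq_irrelevance i_lt isT).
- by rewrite (eq_irrelevance i_lt isT).
Qed.

Lemma braid3_ext (G : groupType) (f g : braid 3 -> G) :
  {morph f : x y / x * y} -> {morph g : x y / x * y} ->
  f s1 = g s1 -> f s2 = g s2 -> f =1 g.
Proof.
move=> fM gM f1 f2; apply: pgroup_hom_ext => //.
exact: (bgen3_ind (P := fun a => f a = g a)).
Qed.

Section Hom.
Variables (G : groupType) (x y : G).
Hypothesis xy : x * y * x = y * x * y.

Definition braid3_hom : braid 3 -> G :=
  pres_hom (fun i : bgen 3 => if val i == 1%N then x else y).

Let hom_rel w w' : braid_rel w w' ->
  word_eval (fun i : bgen 3 => if val i == 1%N then x else y) w =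
  word_eval (fun i : bgen 3 => if val i == 1%N then x else y) w'.
Proof.
case=> [i j|i j] /=; rewrite /word_eval !big_cons !big_nil /= !mulg1.
  (* The indices 1 and 2 are never two apart, so the far relation is void. *)
  by case: i j => [i /andP[i0 i3]] [j /andP[j0 j3]] /=; lia.
case: i j => [[//|[|[|//]]] ?] [j ?] /= ->//=.
by rewrite !mulgA.
Qed.

Lemma braid3_homM : {morph braid3_hom : a b / a * b}.
Proof. exact: pres_homM hom_rel. Qed.

Lemma braid3_hom1 : braid3_hom s1 = x.
Proof. exact: (pres_hom_gen hom_rel). Qed.

Lemma braid3_hom2 : braid3_hom s2 = y.
Proof. exact: (pres_hom_gen hom_rel). Qed.
End Hom.
End ThreeStrands.

Section FourStrands.
Notation s1 := (@sigma 4 1 isT).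
Notation s2 := (@sigma 4 2 isT).
Notation s3 := (@sigma 4 3 isT).

Lemma braid4_rel12 : s1 * s2 * s1 = s2 * s1 * s2.
Proof. exact: pgen_braid. Qed.

Lemma braid4_rel23 : s2 * s3 * s2 = s3 * s2 * s3.
Proof. exact: pgen_braid. Qed.

Lemma braid4_rel13 : s1 * s3 = s3 * s1.
Proof.
rewrite -!(pclsM _ [:: _] [:: _]); apply/pclsP/PresRel.
exact: (@BraidFar 4 (exist _ 1%N isT) (exist _ 3%N isT) isT).
Qed.

Lemma bgen4_ind (P : braid 4 -> Prop) :
  P s1 -> P s2 -> P s3 -> forall i, P (pgen (@braid_rel 4) i).
Proof.
move=> P1 P2 P3 [[//|[|[|[|//]]]] i_lt].
- by rewrite (eq_irrelevance i_lt isT).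
- by rewrite (eq_irrelevance i_lt isT).
- by rewrite (eq_irrelevance i_lt isT).
Qed.

Lemma braid4_ext (G : groupType) (f g : braid 4 -> G) :
  {morph f : x y / x * y} -> {morph g : x y / x * y} ->
  f s1 = g s1 -> f s2 = g s2 -> f s3 = g s3 -> f =1 g.
Proof.
move=> fM gM f1 f2 f3; apply: pgroup_hom_ext => //.
exact: (bgen4_ind (P := fun a => f a = g a)).
Qed.

Section Hom.
Variables (G : groupType) (x y z : G).
Hypotheses (xy : x * y * x = y * x * y) (yz : y * z * y = z * y * z).
Hypothesis xz : x * z = z * x.

(** Generators are numbered from 1, so entry 0 of the list is a filler. *)
Definition braid4_hom : braid 4 -> G :=
  pres_hom (fun i : bgen 4 => nth 1 [:: 1; x; y; z] (val i)).

Let hom_rel w w' : braid_rel w w' ->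
  word_eval (fun i : bgen 4 => nth 1 [:: 1; x; y; z] (val i)) w =
  word_eval (fun i : bgen 4 => nth 1 [:: 1; x; y; z] (val i)) w'.
Proof.
case=> [i j|i j] /=; rewrite /word_eval !big_cons !big_nil /= !mulg1.
  case: i j => [i i_lt] [j j_lt] /=.
  (* The only far pair is 1 and 3, in either order, covered by [xz]. *)
  by case: i i_lt => [|[|[|[|i]]]] //; case: j j_lt => [|[|[|[|j]]]].
case: i j => [i i_lt] [j j_lt] /= jE; move: j_lt; rewrite {}jE.
by case: i i_lt => [//|[|[|i]]] // _ _ /=; rewrite !mulgA.
Qed.

Lemma braid4_homM : {morph braid4_hom : a b / a * b}.
Proof. exact: pres_homM hom_rel. Qed.

Lemma braid4_hom1 : braid4_hom s1 = x.
Proof. exact: (pres_hom_gen hom_rel). Qed.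

Lemma braid4_hom2 : braid4_hom s2 = y.
Proof. exact: (pres_hom_gen hom_rel). Qed.

Lemma braid4_hom3 : braid4_hom s3 = z.
Proof. exact: (pres_hom_gen hom_rel). Qed.
End Hom.
End FourStrands.

(** * Automorphisms of F_2 and equivariant maps *)

Lemma F2_hom_mem (G : groupType) (H : subgroup G) (p q : G) w :
  sgset H p -> sgset H q -> sgset H (F2_hom p q w).
Proof.
move=> Hp Hq; have hM := @F2_homM _ p q.
move: w; apply: pgroup_ind => [|x y Hx Hy|x Hx|[]].
- by rewrite (morph_one hM); exact: sg1.
- by rewrite hM; exact: sgM.
- by rewrite (morph_inv hM); exact: sgV.
- by rewrite -/F2x F2_hom_x.
- by rewrite -/F2y F2_hom_y.
Qed.

Lemma F2_homV (G : groupType) (p q : G) w :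
  F2_hom p q w^-1 = (F2_hom p q w)^-1.
Proof. exact: (morph_inv (@F2_homM _ p q)). Qed.

Definition F2E (G : groupType) (p q : G) := (F2_homM p q, F2_homV p q,
  F2_hom_x p q, F2_hom_y p q).

Section F2Automorphism.
Variables p q p' q' : F2.
Hypotheses (px : F2_hom p q p' = F2x) (py : F2_hom p q q' = F2y).
Hypotheses (px' : F2_hom p' q' p = F2x) (py' : F2_hom p' q' q = F2y).

(** [p], [q] are the images of the generators, and [p'], [q'] those under the inverse; freeness
    reduces invertibility to four word identities. *)
Definition F2_aut : aut F2.
Proof.
apply: (@Aut _ (F2_hom p q) (F2_hom p' q')).
- by move=> w; rewrite (F2_hom_comp _ _ (F2_homM p' q')) px' py' F2_hom_id.
- by move=> w; rewrite (F2_hom_comp _ _ (F2_homM p q)) px py F2_hom_id.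
- exact: F2_homM.
Defined.

Lemma F2_aut_x : F2_aut F2x = p. Proof. exact: F2_hom_x. Qed.
Lemma F2_aut_y : F2_aut F2y = q. Proof. exact: F2_hom_y. Qed.
Lemma F2_autV_x : F2_aut^-1 F2x = p'. Proof. exact: F2_hom_x. Qed.
Lemma F2_autV_y : F2_aut^-1 F2y = q'. Proof. exact: F2_hom_y. Qed.
End F2Automorphism.

Lemma autV (N : groupType) (f : aut N) x : f x^-1 = (f x)^-1.
Proof. exact: (morph_inv (@autM _ f)). Qed.

Section Equivariance.
Variables (N G : groupType) (f : N -> G).

(** The hypothesis of [sdprod_homM] for a single acting element. The closure properties below reduce
    it to generators of the acting group. *)
Definition equivariant (p : aut N) (g : G) :=
  forall n, f (p n) = g * f n * g^-1.

Lemma equivariant1 : equivariant 1 1.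
Proof. by move=> n; rewrite !gnorm. Qed.

Lemma equivariantM p q g h :
  equivariant p g -> equivariant q h -> equivariant (p * q) (g * h).
Proof. by move=> pg qh n; rewrite aut_mulE pg qh !gnorm. Qed.

Lemma equivariantV p g : equivariant p g -> equivariant p^-1 g^-1.
Proof.
move=> pg n; have := pg (p^-1 n); rewrite -aut_mulE mulgV => ->.
by rewrite !gnorm.
Qed.

Lemma equivariantX p g k : equivariant p g -> equivariant (p ^+ k) (g ^+ k).
Proof.
move=> pg; elim: k => [|k IH]; first exact: equivariant1.
by rewrite !expgS; exact: equivariantM.
Qed.

Lemma equivariant_zpow p g z :
  equivariant p g -> equivariant (zpow p z) (zpow g z).
Proof.
move=> pg; case: z => k; first exact: equivariantX.
by apply: equivariantV; exact: equivariantX.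
Qed.
End Equivariance.

Lemma F2_equivariant (G : groupType) (f : F2 -> G) (p : aut F2) (g : G) :
  {morph f : x y / x * y} -> f (p F2x) = g * f F2x * g^-1 ->
  f (p F2y) = g * f F2y * g^-1 -> equivariant f p g.
Proof.
move=> fM fx fy; apply: F2_hom_ext => // [x y|x y].
  by rewrite autM fM.
by rewrite fM !gnorm.
Qed.

(** * Pairs of elements satisfying the braid relation *)

Lemma braid_conj (G : groupType) (x y : G) :
  x * y * x = y * x * y -> x * y * x^-1 = y^-1 * x * y.
Proof.
by move=> xy; apply: (@mulIg _ x); apply: (@mulgI _ y); rewrite !gnorm xy.
Qed.

Section BraidedPair.
Variables (G : groupType) (x y : G).

(* The elements u and v of the braid group, for a pair (σ_1, σ_2). *)
Definition bu : G := y * x^-1.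
Definition bv : G := x * y * x ^- 2.

Lemma buJ : x * bu * x^-1 = bv.
Proof. by rewrite /bv /bu expg2 !gnorm. Qed.

Hypothesis xy : x * y * x = y * x * y.

Lemma bvJ : x * bv * x^-1 = bu^-1 * bv.
Proof.
rewrite /bv /bu expg2 !gnorm; congr (_ * _ * _).
by rewrite -!mulgA; congr (_ * _); rewrite !mulgA braid_conj.
Qed.

Lemma bu_der1 : sgset (der G 1) bu.
Proof. exact: der1_braided. Qed.

Lemma bv_der1 : sgset (der G 1) bv.
Proof. by rewrite -buJ; apply: nsgP; exact: bu_der1. Qed.
End BraidedPair.

Lemma bu_morph (G H : groupType) (f : G -> H) x y :
  {morph f : x y / x * y} -> f (bu x y) = bu (f x) (f y).
Proof. by move=> fM; rewrite /bu (morph_div fM). Qed.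

Lemma bv_morph (G H : groupType) (f : G -> H) x y :
  {morph f : x y / x * y} -> f (bv x y) = bv (f x) (f y).
Proof. by move=> fM; rewrite /bv !expg2 !gnorm !(fM, morph_inv fM). Qed.

(** * Three strands *)

Section B3.
Notation s1 := (@sigma 3 1 isT).
Notation s2 := (@sigma 3 2 isT).

(** Conjugation by σ_1 on F_2(u, v), with [F2x] for u and [F2y] for v, as computed in [buJ] and
    [bvJ]. *)
Definition sigma1_uv : aut F2.
Proof.
apply: (@F2_aut F2y (F2x^-1 * F2y) (F2x * F2y^-1) F2x).
all: by rewrite !F2E ?gnorm.
Defined.

Lemma sigma1_uv_x : sigma1_uv F2x = F2y. Proof. exact: F2_aut_x. Qed.
Lemma sigma1_uv_y : sigma1_uv F2y = F2x^-1 * F2y. Proof. exact: F2_aut_y. Qed.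

Definition act_uv : gact Z1 F2 := gact_of_hom (zpowM sigma1_uv).

Lemma act_uvE w : act_uv Zgen w = sigma1_uv w. Proof. by []. Qed.

Definition F2_B3 : F2 -> braid 3 := F2_hom (bu s1 s2) (bv s1 s2).

Lemma F2_B3M : {morph F2_B3 : x y / x * y}.
Proof. exact: F2_homM. Qed.

Definition sd_B3 (x : sdprod act_uv) : braid 3 :=
  F2_B3 x.1 * zpow s1 x.2.

Lemma sd_B3M : {morph sd_B3 : x y / x * y}.
Proof.
apply: sdprod_homM; [exact: F2_B3M | exact: zpowM | move=> q n].
apply/equivariant_zpow/F2_equivariant; first exact: F2_B3M.
- by rewrite sigma1_uv_x /F2_B3 F2_hom_x F2_hom_y buJ.
- by rewrite sigma1_uv_y /F2_B3 !F2E bvJ //; exact: braid3_rel.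
Qed.

(** The image of σ_2 is dictated by σ_2 = u σ_1. *)
Definition B3_sd : braid 3 -> sdprod act_uv :=
  braid3_hom ((1, Zgen) : sdprod act_uv) (F2x, Zgen).

(** The first components of the two sides are v and u (u^-1 v). *)
Let sd_rel : let x := (1, Zgen) : sdprod act_uv in
  let y := (F2x, Zgen) : sdprod act_uv in x * y * x = y * x * y.
Proof.
move=> x y; rewrite /x /y !sdprodME; congr pair.
by rewrite !(actA, gact_one) /fst /snd !act_uvE !sigma1_uv_x sigma1_uv_y !gnorm.
Qed.

Lemma B3_sdM : {morph B3_sd : x y / x * y}.
Proof. exact: braid3_homM sd_rel. Qed.

Lemma B3_sd1 : B3_sd s1 = (1, Zgen).
Proof. exact: (braid3_hom1 sd_rel). Qed.

Lemma B3_sd2 : B3_sd s2 = (F2x, Zgen).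
Proof. exact: (braid3_hom2 sd_rel). Qed.

Lemma B3_sdK : cancel B3_sd sd_B3.
Proof.
apply: braid3_ext => // [x y||]; first by rewrite B3_sdM sd_B3M.
- by rewrite B3_sd1 /sd_B3 /= (morph_one F2_B3M) mul1g.
- by rewrite B3_sd2 /sd_B3 /F2_B3 /= F2_hom_x /bu mulgVK.
Qed.

Lemma B3_sd_F2 w : B3_sd (F2_B3 w) = (w, 1).
Proof.
have M : {morph (fun w => (w, 1) : sdprod act_uv) : x y / x * y}.
  by move=> x y; rewrite sdprodME act1 mulg1.
have Mc : {morph B3_sd \o F2_B3 : x y / x * y}.
  by move=> x y /=; rewrite F2_B3M B3_sdM.
(* The value at u is read off from u σ_1 = σ_2, which avoids computing inverses in the semidirect
   product. *)
have Eu : B3_sd (bu s1 s2) = (F2x, 1).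
  apply: (@mulIg _ (B3_sd s1)); rewrite -B3_sdM mulgVK B3_sd1 B3_sd2.
  by rewrite sdprodME act1 mulg1 mul1g.
move: w; apply: (F2_hom_ext Mc M); rewrite /= /F2_B3 F2E //.
rewrite -buJ; apply: (@mulIg _ (B3_sd s1)); rewrite -B3_sdM mulgVK B3_sdM.
rewrite Eu B3_sd1 !sdprodME act1 !mulg1 !mul1g act_uvE sigma1_uv_x.
by [].
Qed.

Lemma F2_B3_inj : injective F2_B3.
Proof. by move=> w w' /(congr1 B3_sd); rewrite !B3_sd_F2 => -[]. Qed.

Lemma B3_sd2M : {morph (fun x => (B3_sd x).2) : x y / x * y}.
Proof. by move=> x y; rewrite B3_sdM. Qed.

(** The projection to Z kills the derived subgroup, which leaves only the F_2 factor of an element.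
    Conversely, u and v lie in the derived subgroup. *)
Lemma der1_B3 : sgset (der (braid 3) 1) = range F2_B3.
Proof.
apply/seteqP; split=> [x x1|_ [w _ <-]].
  exists (B3_sd x).1 => //; rewrite -[RHS]B3_sdK /sd_B3.
  by rewrite (morph_der1 B3_sd2M Z1_abelian x1) mulg1.
by apply: F2_hom_mem; [apply: bu_der1 | apply: bv_der1]; exact: braid3_rel.
Qed.

Lemma der2_B3 : sgset (der (braid 3) 2) = F2_B3 @` sgset (der F2 1).
Proof.
(* [der F2 0] is all of F_2, so this is the base case of both shifted inclusions. *)
have E : sgset (der (braid 3) 1) = F2_B3 @` sgset (der F2 0) := der1_B3.
apply/seteqP; split.
  by apply: (der_image F2_B3M _ (k := 1)); rewrite E.
by apply: (der_homo F2_B3M _ (k := 1)); rewrite E.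
Qed.
End B3.

(** * The quotient of B_3 by its second derived subgroup *)

Lemma morph_zpow (G H : groupType) (f : G -> H) g (z : Z1) :
  {morph f : x y / x * y} -> f (zpow g z) = zpow (f g) z.
Proof.
move=> fM; have fX k : f (g ^+ k) = f g ^+ k.
  by elim: k => [|k IH]; rewrite ?(morph_one fM) // !expgS fM IH.
by case: z => k; rewrite /zpow ?(morph_inv fM) fX.
Qed.

Lemma zpow_Zgen (z : Z1) : zpow Zgen z = z.
Proof.
have ZX k : Zgen ^+ k = (Posz k : Z1).
  elim: k => // k IH; rewrite expgS IH.
  by change ((1 + Posz k)%R = Posz k.+1); lia.
by case: z => k; rewrite /zpow ZX.
Qed.

Lemma F2_ab_surj (z : Z2) : exists w, F2_ab w = z.
Proof.
case: z => m n; exists (zpow F2x (m : Z1) * zpow F2y (n : Z1)).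
have abM : {morph F2_ab : x y / x * y} by exact: F2_homM.
rewrite abM !(morph_zpow _ _ abM) /F2_ab F2_hom_x F2_hom_y.
have M1 : {morph (fun m : Z1 => ((m : int, 0%R) : Z2)) : x y / x * y}.
  by move=> x y; congr pair; rewrite addr0.
have M2 : {morph (fun n : Z1 => ((0%R, n : int) : Z2)) : x y / x * y}.
  by move=> x y; congr pair; rewrite addr0.
(* The basis vectors are images of the generator of Z under the coordinate inclusions, which commute
   with powers. *)
rewrite -[Ze1]/((fun m : Z1 => ((m : int, 0%R) : Z2)) Zgen).
rewrite -(morph_zpow _ _ M1).
rewrite -[Ze2]/((fun n : Z1 => ((0%R, n : int) : Z2)) Zgen).
rewrite -(morph_zpow _ _ M2).
by rewrite !zpow_Zgen; congr pair; [exact: addr0 | exact: add0r].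
Qed.

(** The automorphism that [sigma1_uv] induces on the Abelianisation: e_1 goes to e_2, and e_2 to
    -e_1 + e_2. *)
Definition sigma1_Z2 : aut Z2.
Proof.
apply: (@Aut Z2 (fun x => ((- x.2)%R, (x.1 + x.2)%R))
                (fun x => ((x.1 + x.2)%R, (- x.1)%R))).
- by move=> [x y] /=; congr pair; lia.
- by move=> [x y] /=; congr pair; lia.
- by move=> [x y] [x' y']; congr pair => /=; [exact: opprD | exact: addrACA].
Defined.

Definition act_Z2 : gact Z1 Z2 := gact_of_hom (zpowM sigma1_Z2).

Section B3Quotient.
Notation s1 := (@sigma 3 1 isT).
Notation s2 := (@sigma 3 2 isT).

Lemma act_Z2_1 : act_Z2 Zgen Ze1 = Ze2. Proof. by []. Qed.
Lemma act_Z2_2 : act_Z2 Zgen Ze2 = Ze1^-1 * Ze2. Proof. by []. Qed.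

Let ab_rel : let x := (1, Zgen) : sdprod act_Z2 in
  let y := (Ze1, Zgen) : sdprod act_Z2 in x * y * x = y * x * y.
Proof. by []. Qed.

(** This is [B3_sd] followed by Abelianisation of the F_2 factor, given directly on generators. *)
Definition B3_ab : braid 3 -> sdprod act_Z2 :=
  braid3_hom ((1, Zgen) : sdprod act_Z2) (Ze1, Zgen).

Lemma B3_abM : {morph B3_ab : x y / x * y}.
Proof. exact: braid3_homM ab_rel. Qed.

Lemma B3_ab1 : B3_ab s1 = (1, Zgen).
Proof. exact: (braid3_hom1 ab_rel). Qed.

Lemma B3_ab2 : B3_ab s2 = (Ze1, Zgen).
Proof. exact: (braid3_hom2 ab_rel). Qed.

Lemma B3_ab_bu : B3_ab (bu s1 s2) = (Ze1, 1).
Proof.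
apply: (@mulIg _ (B3_ab s1)); rewrite -B3_abM mulgVK B3_ab1 B3_ab2.
by rewrite sdprodME act1 mulg1 mul1g.
Qed.

Lemma B3_ab_bv : B3_ab (bv s1 s2) = (Ze2, 1).
Proof.
rewrite -buJ; apply: (@mulIg _ (B3_ab s1)); rewrite -B3_abM mulgVK B3_abM.
by rewrite B3_ab_bu B3_ab1 !sdprodME act1 !mulg1 !mul1g act_Z2_1.
Qed.

Lemma B3_ab_F2 w : B3_ab (F2_B3 w) = (F2_ab w, 1).
Proof.
have M : {morph (fun w => (F2_ab w, 1) : sdprod act_Z2) : x y / x * y}.
  by move=> x y; rewrite sdprodME act1 mulg1 /F2_ab F2_homM.
have Mc : {morph B3_ab \o F2_B3 : x y / x * y}.
  by move=> x y /=; rewrite F2_B3M B3_abM.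
move: w; apply: (F2_hom_ext Mc M); rewrite /= /F2_B3 /F2_ab !F2E.
- exact: B3_ab_bu.
- exact: B3_ab_bv.
Qed.

Lemma B3_ab_ker x : sgset (der (braid 3) 2) x <-> B3_ab x = 1.
Proof.
rewrite der2_B3; split=> [[w /F2_ab_ker abw <-]|abx].
  by rewrite B3_ab_F2 abw.
have ab2M : {morph (fun x => (B3_ab x).2) : x y / x * y}.
  by move=> y z; rewrite B3_abM.
(* [B3_sd] and [B3_ab] have the same Z-coordinate, so the kernel lies in the F_2 factor, where
   [F2_ab_ker] applies. *)
have x2 : (B3_sd x).2 = 1.
  transitivity (B3_ab x).2; last by rewrite abx.
  move: x {abx}; apply: (braid3_ext B3_sd2M ab2M).
    by rewrite B3_sd1 B3_ab1.
  by rewrite B3_sd2 B3_ab2.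
have xE : x = F2_B3 (B3_sd x).1 by rewrite -[LHS]B3_sdK /sd_B3 x2 mulg1.
exists (B3_sd x).1 => //; apply/F2_ab_ker.
by move: abx; rewrite {1}xE B3_ab_F2 => -[].
Qed.

Lemma B3_ab_surj y : exists x, B3_ab x = y.
Proof.
case: y => z n; have [w wz] := F2_ab_surj z.
exists (F2_B3 w * zpow s1 n).
rewrite B3_abM B3_ab_F2 wz (morph_zpow _ _ B3_abM) B3_ab1.
have M : {morph (fun n : Z1 => (1, n) : sdprod act_Z2) : x y / x * y}.
  by move=> x y; rewrite sdprodME gact_one mulg1.
rewrite -(morph_zpow _ _ M) zpow_Zgen sdprodME act1 mulg1 mul1g.
by [].
Qed.
End B3Quotient.

(** * Four strands *)

Section B4.
Notation t1 := (@sigma 3 1 isT).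
Notation t2 := (@sigma 3 2 isT).
Notation s1 := (@sigma 4 1 isT).
Notation s2 := (@sigma 4 2 isT).
Notation s3 := (@sigma 4 3 isT).

(** From here on [F2x] and [F2y] also stand for a and b. [rho1] and [rho2] model conjugation by σ_1
    and σ_2; the formulas in B_4 are [s1B4a], [s1B4b], [s2B4a] and [s2B4b]. *)
Definition rho1 : aut F2.
Proof.
apply: (@F2_aut F2x (F2x^-1 * F2y) F2x (F2x * F2y)).
all: by rewrite !F2E ?gnorm.
Defined.

Definition rho2 : aut F2.
Proof.
apply: (@F2_aut F2y (F2y * F2x^-1 * F2y) (F2x * F2y^-1 * F2x) F2x).
all: by rewrite !F2E ?gnorm.
Defined.

Lemma rho1x : rho1 F2x = F2x. Proof. exact: F2_aut_x. Qed.
Lemma rho1y : rho1 F2y = F2x^-1 * F2y. Proof. exact: F2_aut_y. Qed.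
Lemma rho1Vx : rho1^-1 F2x = F2x. Proof. exact: F2_autV_x. Qed.
Lemma rho1Vy : rho1^-1 F2y = F2x * F2y. Proof. exact: F2_autV_y. Qed.
Lemma rho2x : rho2 F2x = F2y. Proof. exact: F2_aut_x. Qed.
Lemma rho2y : rho2 F2y = F2y * F2x^-1 * F2y. Proof. exact: F2_aut_y. Qed.

Definition rhoE := (aut_mulE, @autM F2, autV,
  rho1x, rho1y, rho1Vx, rho1Vy, rho2x, rho2y).

Let rho_rel : rho1 * rho2 * rho1 = rho2 * rho1 * rho2.
Proof.
apply: aut_eq; apply: F2_hom_ext; try exact: autM.
  by rewrite !rhoE !gnorm.
by rewrite !rhoE !gnorm.
Qed.

Definition rho : braid 3 -> aut F2 := braid3_hom rho1 rho2.

Lemma rhoM : {morph rho : x y / x * y}.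
Proof. exact: braid3_homM rho_rel. Qed.

Lemma rho_t1 : rho t1 = rho1. Proof. exact: (braid3_hom1 rho_rel). Qed.
Lemma rho_t2 : rho t2 = rho2. Proof. exact: (braid3_hom2 rho_rel). Qed.

Definition act_rho : gact (braid 3) F2 := gact_of_hom rhoM.

Lemma act_rhoE g w : act_rho g w = rho g w. Proof. by []. Qed.

Definition B3_B4 : braid 3 -> braid 4 := braid3_hom s1 s2.

Lemma B3_B4M : {morph B3_B4 : x y / x * y}.
Proof. exact: braid3_homM braid4_rel12. Qed.

Lemma B3_B4_t1 : B3_B4 t1 = s1. Proof. exact: (braid3_hom1 braid4_rel12). Qed.
Lemma B3_B4_t2 : B3_B4 t2 = s2. Proof. exact: (braid3_hom2 braid4_rel12). Qed.

Definition B4a := s3 * s1^-1.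
Definition B4b := bu s1 s2 * B4a * (bu s1 s2)^-1.

Lemma braid13V : s1^-1 * s3 = s3 * s1^-1.
Proof. exact/commute_sym/commuteV/commute_sym/braid4_rel13. Qed.

Lemma B4bE : B4b = s2 * s3 * s1^-1 * s2^-1.
Proof.
rewrite /B4b /B4a /bu !gnorm; congr (_ * _); rewrite -!mulgA; congr (_ * _).
exact: braid13V.
Qed.

Lemma s1B4a : s1 * B4a * s1^-1 = B4a.
Proof. by rewrite /B4a !gnorm braid4_rel13 !gnorm. Qed.

Lemma s2B4a : s2 * B4a * s2^-1 = B4b.
Proof. by rewrite B4bE /B4a !gnorm. Qed.

Lemma s1B4b : s1 * B4b * s1^-1 = B4a^-1 * B4b.
Proof.
(* The braid relation of σ_2 and σ_3 rearranges the right-hand side; what remains is the inverse of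
   that of σ_1 and σ_2. *)
have conj23 : s3^-1 * s2 * s3 = s2 * s3 * s2^-1.
  by rewrite braid_conj // braid4_rel23.
rewrite B4bE /B4a !gnorm -!(mulgA s1); congr (s1 * _).
rewrite conj23 -!(mulgA (s2 * s3)); congr (_ * _).
by apply: invg_inj; rewrite !gnorm -braid4_rel12.
Qed.

Lemma s2B4b : s2 * B4b * s2^-1 = B4b * B4a^-1 * B4b.
Proof.
(* Each rule rewrites the end of a left-associated word, hence the prefix z. *)
have move1 z : z * s1^-1 * s2^-1 * s1 = z * s2 * s1^-1 * s2^-1.
  rewrite -!mulgA; congr (z * _); apply: invg_inj.
  by rewrite !gnorm braid_conj // -braid4_rel12.
have move2 z : z * s1^-1 * s2^-1 * s1^-1 = z * s2^-1 * s1^-1 * s2^-1.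
  by apply: invg_inj; rewrite !gnorm braid4_rel12.
have move3 z : z * s1^-1 * s3 = z * s3 * s1^-1.
  by rewrite -!mulgA braid13V.
have move4 z : z * s3 * s2 * s3 = z * s2 * s3 * s2.
  by rewrite -!(mulgA z) -braid4_rel23.
(* Reading a^-1 b as σ_1 b σ_1^-1 leaves a right-hand side free of a. *)
rewrite -[RHS]mulgA -s1B4b B4bE !gnorm move1 mulgVK move3 !move2 move4.
by rewrite mulgK.
Qed.

Definition F2_B4 : F2 -> braid 4 := F2_hom B4a B4b.

Lemma F2_B4M : {morph F2_B4 : x y / x * y}.
Proof. exact: F2_homM. Qed.

(** The property is closed under the group operations, and the four conjugation formulas settle the
    generators of B_3. *)
Lemma F2_B4_equivariant g : equivariant F2_B4 (rho g) (B3_B4 g).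
Proof.
move: g; apply: pgroup_ind => [|g h|g|].
- rewrite (morph_one rhoM) (morph_one B3_B4M); exact: equivariant1.
- by rewrite rhoM B3_B4M; exact: equivariantM.
- by rewrite (morph_inv rhoM) (morph_inv B3_B4M); exact: equivariantV.
apply: (bgen3_ind (P := fun g => equivariant F2_B4 (rho g) (B3_B4 g))).
- rewrite rho_t1 B3_B4_t1; apply: F2_equivariant; first exact: F2_B4M.
    by rewrite rho1x /F2_B4 !F2E s1B4a.
  by rewrite rho1y /F2_B4 !F2E s1B4b.
- rewrite rho_t2 B3_B4_t2; apply: F2_equivariant; first exact: F2_B4M.
    by rewrite rho2x /F2_B4 !F2E s2B4a.
  by rewrite rho2y /F2_B4 !F2E s2B4b.
Qed.

Definition sd_B4 (x : sdprod act_rho) : braid 4 := F2_B4 x.1 * B3_B4 x.2.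

Lemma sd_B4M : {morph sd_B4 : x y / x * y}.
Proof.
by apply: sdprod_homM F2_B4M B3_B4M _ => g; exact: F2_B4_equivariant.
Qed.

Let B3_inr g : sdprod act_rho := (1, g).

Let B3_inrM : {morph B3_inr : x y / x * y}.
Proof. by move=> x y; rewrite sdprodME gact_one mulg1. Qed.

Let sd_rel23 : let y := (1, t2) : sdprod act_rho in
  let z := (F2x, t1) : sdprod act_rho in y * z * y = z * y * z.
Proof.
move=> y z; rewrite /y /z !sdprodME; congr pair; last by rewrite -braid3_rel.
rewrite /fst /snd !gact_one !(actA, act_rhoE) rho_t1 rho_t2.
by rewrite !rhoE !gnorm.
Qed.

Let sd_rel13 : let x := (1, t1) : sdprod act_rho in
  let z := (F2x, t1) : sdprod act_rho in x * z = z * x.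
Proof.
move=> x z; rewrite /x /z !sdprodME; congr pair.
by rewrite /fst /snd !gact_one act_rhoE rho_t1 rho1x !gnorm.
Qed.

Let sd_rel12 : B3_inr t1 * B3_inr t2 * B3_inr t1 =
  B3_inr t2 * B3_inr t1 * B3_inr t2.
Proof. by rewrite -!B3_inrM braid3_rel. Qed.

(** The image of σ_3 is dictated by σ_3 = a σ_1. *)
Definition B4_sd : braid 4 -> sdprod act_rho :=
  braid4_hom ((1, t1) : sdprod act_rho) (1, t2) (F2x, t1).

Lemma B4_sdM : {morph B4_sd : x y / x * y}.
Proof. exact: braid4_homM sd_rel12 sd_rel23 sd_rel13. Qed.

Lemma B4_sd1 : B4_sd s1 = (1, t1).
Proof. exact: (braid4_hom1 sd_rel12 sd_rel23 sd_rel13). Qed.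
Lemma B4_sd2 : B4_sd s2 = (1, t2).
Proof. exact: (braid4_hom2 sd_rel12 sd_rel23 sd_rel13). Qed.
Lemma B4_sd3 : B4_sd s3 = (F2x, t1).
Proof. exact: (braid4_hom3 sd_rel12 sd_rel23 sd_rel13). Qed.

Lemma B4_sdK : cancel B4_sd sd_B4.
Proof.
apply: braid4_ext => // [x y|||]; first by rewrite B4_sdM sd_B4M.
- by rewrite B4_sd1 /sd_B4 /= (morph_one F2_B4M) mul1g B3_B4_t1.
- by rewrite B4_sd2 /sd_B4 /= (morph_one F2_B4M) mul1g B3_B4_t2.
- by rewrite B4_sd3 /sd_B4 /F2_B4 /= F2_hom_x B3_B4_t1 /B4a mulgVK.
Qed.

Lemma B4_sd_B3 g : B4_sd (B3_B4 g) = (1, g).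
Proof.
have Mc : {morph B4_sd \o B3_B4 : x y / x * y}.
  by move=> x y /=; rewrite B3_B4M B4_sdM.
move: g; apply: (braid3_ext Mc B3_inrM) => /=.
  by rewrite B3_B4_t1 B4_sd1.
by rewrite B3_B4_t2 B4_sd2.
Qed.

Lemma B4_sd_F2 w : B4_sd (F2_B4 w) = (w, 1).
Proof.
have M : {morph (fun w => (w, 1) : sdprod act_rho) : x y / x * y}.
  by move=> x y; rewrite sdprodME act1 mulg1.
have Mc : {morph B4_sd \o F2_B4 : x y / x * y}.
  by move=> x y /=; rewrite F2_B4M B4_sdM.
have Ea : B4_sd B4a = (F2x, 1).
  apply: (@mulIg _ (B4_sd s1)); rewrite -B4_sdM mulgVK B4_sd1 B4_sd3.
  by rewrite sdprodME act1 mulg1 mul1g.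
move: w; apply: (F2_hom_ext Mc M); rewrite /= /F2_B4 F2E //.
rewrite -s2B4a; apply: (@mulIg _ (B4_sd s2)); rewrite -B4_sdM mulgVK B4_sdM.
rewrite Ea B4_sd2 !sdprodME act1 !mulg1 !mul1g act_rhoE rho_t2 rho2x.
by [].
Qed.

Lemma sd_B4K : cancel sd_B4 B4_sd.
Proof.
case=> w g; rewrite /sd_B4 B4_sdM B4_sd_F2 B4_sd_B3 sdprodME act1 mulg1 mul1g.
by [].
Qed.

(** The retraction of B_4 onto B_3 that sends σ_3 to σ_1; its kernel is F_2(a, b). *)
Definition B4_B3 (x : braid 4) : braid 3 := (B4_sd x).2.

Lemma B4_B3M : {morph B4_B3 : x y / x * y}.
Proof. by move=> x y; rewrite /B4_B3 B4_sdM. Qed.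

Lemma B4_decomp x : F2_B4 (B4_sd x).1 * B3_B4 (B4_B3 x) = x.
Proof. exact: B4_sdK. Qed.

Lemma B3_B4K : cancel B3_B4 B4_B3.
Proof. by move=> g; rewrite /B4_B3 B4_sd_B3. Qed.

Lemma B3_B4_F2 g : B3_B4 (F2_B3 g) = F2_hom (bu s1 s2) (bv s1 s2) g.
Proof.
rewrite /F2_B3 (F2_hom_comp _ _ B3_B4M) (bu_morph _ _ B3_B4M).
by rewrite (bv_morph _ _ B3_B4M) B3_B4_t1 B3_B4_t2.
Qed.

Lemma der_B3_B4 i g : sgset (der (braid 3) i) g ->
  sgset (der (braid 4) i) (B3_B4 g).
Proof.
move=> g_i; rewrite -(addn0 i); apply: (der_homo B3_B4M (j := 0)) => //.
by exists g; rewrite ?addn0.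
Qed.

Lemma der_B4_B3 i x : sgset (der (braid 4) i) x ->
  sgset (der (braid 3) i) (B4_B3 x).
Proof.
move=> x_i; rewrite -(addn0 i); apply: (der_homo B4_B3M (j := 0)) => //.
by exists x; rewrite ?addn0.
Qed.

(** F_2(u, v) acts through its embedding in B_3, so that agreement with conjugation in B_4 comes
    from [F2_B4_equivariant]. *)
Definition act_F2 : gact F2 F2.
Proof.
apply: (@gact_of_hom _ _ (fun g => rho (F2_B3 g))).
by move=> g h; rewrite F2_B3M rhoM.
Defined.

Lemma act_F2E g w : act_F2 g w = rho (F2_B3 g) w. Proof. by []. Qed.

Lemma act_F2x : act_F2 F2x =1 rho2 * rho1^-1.
Proof.
by move=> w; rewrite act_F2E /F2_B3 F2E (bu_morph _ _ rhoM) rho_t1 rho_t2.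
Qed.

Lemma act_F2y : act_F2 F2y =1 rho1 * rho2 * rho1^-1 * rho1^-1.
Proof.
move=> w; rewrite act_F2E /F2_B3 F2E (bv_morph _ _ rhoM) rho_t1 rho_t2.
by rewrite /bv expg2 !gnorm.
Qed.

Lemma act_F2xx : act_F2 F2x F2x = F2y.
Proof. by rewrite act_F2x !rhoE. Qed.

Lemma act_F2xy : act_F2 F2x F2y = F2y ^+ 2 * F2x^-1 * F2y.
Proof. by rewrite act_F2x !rhoE expg2 !gnorm. Qed.

Lemma act_F2yx : act_F2 F2y F2x = F2x^-1 * F2y.
Proof. by rewrite act_F2y !rhoE. Qed.

Lemma act_F2yy :
  act_F2 F2y F2y = (F2x^-1 * F2y) ^+ 3 * F2x ^- 2 * F2y.
Proof. by rewrite act_F2y !rhoE !expgS expg0 !gnorm. Qed.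

Lemma act_F2_conj g w : F2_B4 (act_F2 g w) =
  F2_hom (bu s1 s2) (bv s1 s2) g * F2_B4 w *
  (F2_hom (bu s1 s2) (bv s1 s2) g)^-1.
Proof. by rewrite act_F2E F2_B4_equivariant B3_B4_F2. Qed.

(** As a, u and v lie in the first derived subgroup, [u, a] and [v, a] lie in the second. Since b is
    a conjugate of a, placing a there suffices. *)
Lemma F2_B4_der2 w : sgset (der (braid 4) 2) (F2_B4 w).
Proof.
have a1 : sgset (der (braid 4) 1) B4a by exact: pgen_der1.
have J g : sgset (der (braid 4) 1) g ->
    sgset (der (braid 4) 2) (g * B4a * g^-1 * B4a^-1).
  move=> g1; have -> : g * B4a * g^-1 * B4a^-1 = [~ g^-1, B4a^-1].
    by rewrite /commg /conjg !gnorm.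
  by apply: derS_mem; exact: sgV.
have ba : sgset (der (braid 4) 2) (B4b * B4a^-1).
  by apply: J; apply: bu_der1; exact: braid4_rel12.
have aba : sgset (der (braid 4) 2) (B4a^-1 * B4b * B4a^-1).
  have := act_F2_conj F2y F2x; rewrite act_F2yx /F2_B4 !F2E => ->.
  by apply: J; apply: bv_der1; exact: braid4_rel12.
(* a is obtained from [u, a] = b a^-1 and [v, a] = a^-1 b a^-1. *)
have a2 : sgset (der (braid 4) 2) B4a.
  have -> : B4a = (B4a * (B4a^-1 * B4b * B4a^-1) * B4a^-1)^-1 * (B4b * B4a^-1).
    by rewrite !gnorm.
  by apply: sgM ba; apply: sgV; exact: nsgP.
by apply: F2_hom_mem => //; exact: nsgP.
Qed.

(** The F_2(a, b) factor is absorbed by [F2_B4_der2]; the homomorphisms between B_4 and B_3 in both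
    directions carry over the rest. *)
Lemma der2_B4 x :
  sgset (der (braid 4) 2) x <-> sgset (der (braid 3) 2) (B4_B3 x).
Proof.
split=> [|x2]; first exact: der_B4_B3.
rewrite -(B4_decomp x); apply: sgM; first exact: F2_B4_der2.
exact: der_B3_B4.
Qed.

(** The isomorphism is induced by B_4^(1) → B_3^(1) = F_2(u, v) → Z^2, whose kernel is B_4^(2) by
    [der2_B4] and [B3_ab_ker]. *)
Lemma der1_B4_quot :
  isog (quot (restr (der (braid 4) 1) (der (braid 4) 2))) Z2.
Proof.
pose h (x : sgtype (der (braid 4) 1)) := (B3_ab (B4_B3 (val x))).1.
(* On B_4^(1) the Z-coordinate is trivial, so the twist in the semidirect product disappears and [h]
   is multiplicative. *)
have h2 (x : sgtype (der (braid 4) 1)) : B3_ab (B4_B3 (val x)) = (h x, 1).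
  have /der_B4_B3 := set_mem (valP x); rewrite der1_B3 => -[w _ wx].
  by rewrite /h -wx B3_ab_F2.
have hM : {morph h : x y / x * y}.
  move=> x y; rewrite {1}/h valM B4_B3M B3_abM !h2 sdprodME act1.
  by [].
have [||f [fiso _]] :=
  quot_giso (N := restr (der (braid 4) 1) (der (braid 4) 2)) hM.
- move=> z; have [w <-] := F2_ab_surj z.
  have x1 : B3_B4 (F2_B3 w) \in sgset (der (braid 4) 1).
    by apply/mem_set/der_B3_B4; rewrite der1_B3; exists w.
  exists (exist _ (B3_B4 (F2_B3 w)) x1 : sgtype (der (braid 4) 1)).
  by rewrite /h /= B3_B4K B3_ab_F2.
- move=> x; rewrite /= /restr_set /=; split.
    by move/der2_B4/B3_ab_ker; rewrite h2 => -[].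
  by move=> hx; apply/der2_B4/B3_ab_ker; rewrite h2 hx.
by exists f.
Qed.

(** By [der2_B4] and [der2_B3], B_4^(2) is the preimage of the copy of Γ_2(F_2(u, v)) in B_3;
    [lcs F2 2] and [der F2 1] unfold to the same commutator. *)
Lemma der2_B4_sdprod :
  exists f : sdprod (gact_restr act_F2 (lcs F2 2)) ->
             sgtype (der (braid 4) 2),
    giso f /\ forall (w : F2) (g : sgtype (lcs F2 2)),
      val (f (w, g)) =
      F2_B4 w * F2_hom (bu s1 s2) (bv s1 s2) (val g).
Proof.
pose k (g : sgtype (lcs F2 2)) := F2_hom (bu s1 s2) (bv s1 s2) (val g).
have kM : {morph k : x y / x * y} by move=> x y; rewrite /k valM F2_homM.
have fk q n : F2_B4 (gact_restr act_F2 (lcs F2 2) q n) =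
    k q * F2_B4 n * (k q)^-1 by exact: act_F2_conj.
have FM := sdprod_homM F2_B4M kM fk.
have [||f [fiso fE]] := @sgtype_giso _ _ (der (braid 4) 2) _ FM.
(* Injectivity: [B4_sd] recovers both factors, and [F2_B3] is injective. *)
- move=> [w g] [w' g'] /=; rewrite /k -!B3_B4_F2 => E.
  have := congr1 B4_sd E.
  rewrite (sd_B4K (w, F2_B3 (val g))) (sd_B4K (w', F2_B3 (val g'))).
  by case=> -> /F2_B3_inj gg; congr pair; exact: val_inj.
- apply/seteqP; split=> [x /der2_B4|_ [[w g] _ <-]].
    rewrite der2_B3 => -[g /mem_set g2 gx].
    exists ((B4_sd x).1, exist _ g g2 : sgtype (lcs F2 2)) => //=.
    by rewrite /k -B3_B4_F2 /= gx B4_decomp.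
  apply/der2_B4; rewrite /fst /snd /k -B3_B4_F2 -/(sd_B4 (w, F2_B3 (val g))).
  rewrite /B4_B3 sd_B4K der2_B3; exists (val g) => //.
  exact: set_mem (valP g).
by exists f; split=> // w g; rewrite fE.
Qed.
End B4.

Theorem proposition5 :
  (forall m s : nat, (1 <= m)%N -> (3 <= s)%N ->
     (lcs (braid m) s : set (braid m)) = lcs (braid m) 2)
  /\
  (forall m s : nat, m = 1%N \/ m = 2%N -> (1 <= s)%N ->
     (der (braid m) s : set (braid m)) = [set 1])
  /\
  (let s1 : braid 3 := @sigma 3 1 isT in
   let s2 : braid 3 := @sigma 3 2 isT in
   let u : braid 3 := s2 * s1^-1 in
   let v : braid 3 := s1 * u * s1^-1 in
   [/\ v = s1 * s2 * s1 ^- 2,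
       exists f : F2 -> sgtype (der (braid 3) 1),
         [/\ giso f, val (f F2x) = u, val (f F2y) = v &
             forall s : nat,
               (der (sgtype (der (braid 3) 1)) s : set _) =
               [set f w | w in (der F2 s : set F2)]] &
       exists al : gact Z1 Z2,
         [/\ al Zgen Ze1 = Ze2,
             al Zgen Ze2 = Ze1^-1 * Ze2 &
             exists f : quot (der (braid 3) 2) -> sdprod al,
               [/\ giso f,
                   f (coset (der (braid 3) 2) u) = (Ze1, 1) &
                   f (coset (der (braid 3) 2) v) = (Ze2, 1)]]])
  /\
  (let s1 : braid 4 := @sigma 4 1 isT in
   let s2 : braid 4 := @sigma 4 2 isT in
   let s3 : braid 4 := @sigma 4 3 isT in
   let u : braid 4 := s2 * s1^-1 in
   let v : braid 4 := s1 * s2 * s1 ^- 2 in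
   let a : braid 4 := s3 * s1^-1 in
   let b : braid 4 := u * a * u^-1 in
   [/\ b = s2 * s3 * s1^-1 * s2^-1,
       isog (quot (restr (der (braid 4) 1) (der (braid 4) 2))) Z2 &
       exists al : gact F2 F2,
         [/\ [/\ al F2x F2x = F2y,
                 al F2x F2y = F2y ^+ 2 * F2x^-1 * F2y,
                 al F2y F2x = F2x^-1 * F2y &
                 al F2y F2y = (F2x^-1 * F2y) ^+ 3 * F2x ^- 2 * F2y],
             forall g w : F2,
               F2_hom a b (al g w) =
               F2_hom u v g * F2_hom a b w * (F2_hom u v g)^-1 &
             exists f : sdprod (gact_restr al (lcs F2 2)) ->
                        sgtype (der (braid 4) 2),
               giso f /\
               forall (w : F2) (g : sgtype (lcs F2 2)),
                 val (f (w, g)) = F2_hom a b w * F2_hom u v (val g)]]).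
Proof.
split; first by move=> m s _; exact: lcs_braid.
split.
  by move=> m s m12; apply: der_braid2; case: m12 => ->.
split.
  move=> s1 s2 u v; have vE : v = bv s1 s2 by exact: buJ.
  split.
  - exact: vE.
  - have [f [fiso fE]] := sgtype_giso F2_B3M F2_B3_inj der1_B3.
    have fM := fiso.1; exists f; split=> //.
    + by rewrite fE /F2_B3 F2_hom_x.
    + by rewrite fE /F2_B3 F2_hom_y vE.
    (* The isomorphism matches the whole groups at level 0, and both inclusions climb from there to
       level [s]; [addn0] exhibits the offset. *)
    move=> s; rewrite -(addn0 s); apply/seteqP; split.
      apply: (der_image fM (i := 0) (j := 0)) => y _.
      by case: fiso.2 => g fK gK; exists (g y).
    exact: (der_homo fM (i := 0) (j := 0)).
  - exists act_Z2; split; [exact: act_Z2_1 | exact: act_Z2_2 |].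
    have [f [fiso fE]] := quot_giso B3_abM B3_ab_surj B3_ab_ker.
    exists f; split=> //; first by rewrite fE; exact: B3_ab_bu.
    by rewrite fE vE; exact: B3_ab_bv.
move=> s1 s2 s3 u v a b; split; [exact: B4bE | exact: der1_B4_quot |].
exists act_F2; split.
- split; [exact: act_F2xx | exact: act_F2xy | exact: act_F2yx |].
  exact: act_F2yy.
- exact: act_F2_conj.
- exact: der2_B4_sdprod.
Qed.
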